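(* Let $\Omega$ be a set with exactly two elements, let $M=(\pi(\omega'\mid\omega))_{\omega,\omega'\in\Omega}$ be the transition matrix of an irreducible Markov chain on $\Omega$, let $r:\Omega\to\mathbb{R}$ and let $\delta\in[0,1)$. Then, in the advisor's decision problem described in the context, the greedy strategy $\sigma_*$ is optimal for every initial distribution $p_1\in\Delta(\Omega)$, i.e. its payoff from $p_1$ equals $V_\delta(p_1)$.
   Context: Identify each $\omega\in\Omega$ with a unit vector of $\mathbb{R}^\Omega$ and $\Delta(\Omega)$ (probability distributions on $\Omega$, the ''beliefs'') with the unit simplex. For $p\in\Delta(\Omega)$ let $\langle p,r\rangle=\sum_\omega p(\omega)r(\omega)$. The investment region is $I=\{p\in\Delta(\Omega):\langle p,r\rangle\ge 0\}$ and $J=\Delta(\Omega)\setminus I$. Let $\phi(q)=qM$ (row vector times matrix). For $p\in\Delta(\Omega)$, $\mathcal{S}(p)$ is the set of Borel probability measures on $\Delta(\Omega)$ with mean $p$ (''splittings at $p$''), and $\mu_p$ is the Dirac mass at $p$. The decision problem from $p_1$: at each stage $n\ge1$, at the current belief $p_n$, the advisor chooses $\mu\in\mathcal{S}(p_n)$ (possibly depending on the past), a posterior $q_n$ is drawn according to $\mu$, the stage payoff is $1$ if $q_n\in I$ and $0$ otherwise, and $p_{n+1}=\phi(q_n)$. A strategy is such a rule for choosing splittings; its payoff is $\mathbb{E}[(1-\delta)\sum_{n\ge1}\delta^{n-1}\mathbf{1}_{\{q_n\in I\}}]$, and $V_\delta(p_1)$ is the supremum (in fact maximum) of the payoff over strategies;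 a strategy is optimal at $p_1$ if it achieves $V_\delta(p_1)$. The greedy strategy $\sigma_*$ is stationary in the belief: at $p\in I$ it chooses $\mu_p$ (no information); at $p\in J$ it chooses a two-point splitting $p=a_Iq_I+a_Jq_J$ (posterior $q_I$ with probability $a_I$, $q_J$ with probability $a_J$) solving: maximize $a_I$ subject to $p=a_Iq_I+a_Jq_J$, $q_I\in I$, $q_J\in\Delta(\Omega)$, $a_I+a_J=1$, $a_I,a_J\ge0$. *)

(* Defs.v *)
From HB Require Import structures.
From mathcomp Require Import all_boot all_order all_algebra.
From mathcomp Require Import all_classical all_reals all_analysis.
From mathcomp Require Import measurable_realfun.
Set Implicit Arguments.
Unset Strict Implicit.
Unset Printing Implicit Defensive.
Import Order.TTheory GRing.Theory Num.Theory.
Local Open Scope classical_set_scope.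
Local Open Scope ring_scope.

(* Omega = bool (a set with exactly two elements).  A belief p in Delta(Omega)
   is represented by the real number x = p(true) in [0,1], so that
   p = (1-x) * false + x * true. *)

Section Model.
Variable R : realType.

(* M w w' = pi(w' | w) *)
Definition stochastic (M : bool -> bool -> R) : Prop :=
  (forall w w', 0 <= M w w') /\ (forall w, \sum_(w' : bool) M w w' = 1).

Fixpoint mpow (M : bool -> bool -> R) (n : nat) : bool -> bool -> R :=
  match n with
  | 0%N => fun w w' => if w == w' then 1 else 0
  | n'.+1 => fun w w' => \sum_(k : bool) mpow M n' w k * M k w'
  end.

Definition irreducible (M : bool -> bool -> R) : Prop :=
  forall w w', exists n, 0 < mpow M n w w'.

Definition in_simplex (x : R) : bool := (0 <= x) && (x <= 1).

Definition pair_r (r : bool -> R) (x : R) : R := (1 - x) * r false + x * r true.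

Definition inI (r : bool -> R) (x : R) : bool := in_simplex x && (0 <= pair_r r x).

(* phi(q) = q M, expressed through its true-coordinate *)
Definition phi (M : bool -> bool -> R) (x : R) : R :=
  (1 - x) * M false true + x * M true true.

Definition is_splitting (p : R) (mu : probability R R) : Prop :=
  mu [set x | in_simplex x] = 1%E /\ (\int[mu]_x (x%:E) = p%:E)%E.

(* belief p_{n+1} after the history h = (q_1,...,q_n) of posteriors *)
Definition belief (M : bool -> bool -> R) (p1 : R) (h : seq R) : R :=
  if h is [::] then p1 else phi M (last 0 h).

Definition in_simplex_hist (h : seq R) : bool := all in_simplex h.

(* A (behavioural, history-dependent) strategy: at stage n+1, after the
   history of posteriors h of length n, choose a splitting at the current
   belief; measurability in the history is required. *)
Definition strategy := forall n : nat, n.-tuple R -> probability R R.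

Definition is_strategy (M : bool -> bool -> R) (p1 : R) (s : strategy) : Prop :=
  (forall n (A : set R), measurable A ->
     measurable_fun [set: n.-tuple R] ((fun h => s n h A) : n.-tuple R -> \bar R)) /\
  (forall n (h : n.-tuple R), in_simplex_hist h ->
     is_splitting (belief M p1 h) (s n h)).

(* expected (undiscounted-normalised) payoff of stages n+1, ..., n+N from
   history h: W_{N+1}(h) = E_{q ~ s h}[ 1_I(q) + delta W_N(h q) ] *)
Fixpoint Wfin (r : bool -> R) (delta : R) (s : strategy) (N : nat)
  : forall n, n.-tuple R -> \bar R :=
  match N with
  | 0%N => fun n h => 0%E
  | N'.+1 => fun n h =>
      (\int[s n h]_q ((if inI r q then 1 else 0)%:E
                      + delta%:E * Wfin r delta s N' [tuple of rcons h q]))%E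
  end.

(* payoff E[(1-delta) sum_{n>=1} delta^{n-1} 1_{q_n in I}], the expectation of
   the series being the supremum of the expectations of its partial sums
   (monotone convergence) *)
Definition payoff (r : bool -> R) (delta : R) (s : strategy) : \bar R :=
  ((1 - delta)%:E * ereal_sup [set Wfin r delta s N [tuple] | N in [set: nat]])%E.

Definition value (M : bool -> bool -> R) (r : bool -> R) (delta p1 : R) : \bar R :=
  ereal_sup [set payoff r delta s | s in [set s | is_strategy M p1 s]].

Definition greedy_rule (r : bool -> R) (g : R -> probability R R) : Prop :=
  forall p, in_simplex p ->
    (inI r p -> forall A, measurable A -> g p A = \d_p A) /\
    (~~ inI r p ->
      exists aI qI qJ,
        [/\ 0 <= aI <= 1, inI r qI, in_simplex qJ,
            p = aI * qI + (1 - aI) * qJ &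
          ((forall a' qI' qJ', 0 <= a' <= 1 -> inI r qI' -> in_simplex qJ' ->
                p = a' * qI' + (1 - a') * qJ' -> a' <= aI) /\
            (forall A, measurable A ->
               g p A = (aI%:E * \d_qI A + (1 - aI)%:E * \d_qJ A)%E))]).

(* the stationary strategy sigma_* induced by g (on histories outside
   Delta(Omega)^n, which are never reached, it plays g p1) *)
Definition greedy_strategy (M : bool -> bool -> R) (p1 : R)
  (g : R -> probability R R) : strategy :=
  fun n h => if in_simplex_hist h then g (belief M p1 h) else g p1.

End Model.

(* Main.v *)
Require Import Defs.
From HB Require Import structures.
From mathcomp Require Import all_boot all_order all_algebra.
From mathcomp Require Import all_classical all_reals all_analysis.
From mathcomp Require Import measurable_realfun.
From mathcomp Require Import ring lra.
Import Order.TTheory GRing.Theory Num.Theory.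
Import numFieldNormedType.Exports.
Local Open Scope classical_set_scope.
Local Open Scope ring_scope.

(* Unless I is everything, J is a segment from an endpoint e of the simplex to
   the frontier point c of I, and greedy splits a belief of J between c and e.
   Its Bellman operator T is thus T f = 1 + h on I and the chord l through
   (e, h e) and (c, 1 + h c) on J, where h = delta * (f \o phi).  If f is
   concave, so is h, and then T f = min (l, 1 + h) on the whole simplex; hence T
   preserves concavity, and the fixed point u of T, which is the greedy payoff,
   is concave.  As phi is 1-Lipschitz, T shrinks slopes off the chord, so u is
   Lipschitz with constant the slope of l; this gives h <= l, i.e. waiting never
   beats u.  A supporting line of u at p then bounds the payoff of every
   splitting at p by u p. *)

(** * Concave functions on the simplex and their supergradients *)

Lemma in_simplex_conv (R : realType) (x y z : R) :
  in_simplex x -> in_simplex y -> 0 <= z <= 1 ->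
  in_simplex (z * x + (1 - z) * y).
Proof.
rewrite /in_simplex => /andP[x0 x1] /andP[y0 y1] /andP[z0 z1].
by apply/andP; split; nra.
Qed.

Definition concave01 {R : realType} (f : R -> R) :=
  forall x y z, in_simplex x -> in_simplex y -> 0 <= z <= 1 ->
  z * f x + (1 - z) * f y <= f (z * x + (1 - z) * y).

Definition lip01 {R : realType} (K : R) (f : R -> R) :=
  forall x y, in_simplex x -> in_simplex y -> `|f x - f y| <= K * `|x - y|.

(** A concave function can have infinite slope at an endpoint; the Lipschitz bound excludes this.
    The supergradient is the supremum of the slopes of the chords to the right of [p]. *)
Lemma concave01_supergradient (R : realType) (K : R) (f : R -> R) (p : R) :
  concave01 f -> lip01 K f -> in_simplex p ->
  exists k, forall q, in_simplex q -> f q <= f p + k * (q - p).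
Proof.
move=> cf lf p01; have /andP[p0 p1] := p01.
have [p_1|p_neq1] := eqVneq p 1.
  (* At the right endpoint there are no chords to the right; all beliefs lie on its left, where
     slope [- K] suffices. *)
  exists (- K) => q q01; have /andP[q0 q1] := q01.
  have := lf q p q01 p01.
  rewrite [`|q - p|]ler0_norm ?subr_le0 ?p_1 // => h.
  by have := ler_norm (f q - f 1); lra.
have pl1 : p < 1 by rewrite lt_neqAle p_neq1.
pose E := [set k | exists y, [/\ in_simplex y, p < y & k = (f y - f p) / (y - p)]].
have one01 : in_simplex (1 : R) by rewrite /in_simplex ler01 lexx.
have E0 : E !=set0 by exists ((f 1 - f p) / (1 - p)), 1.
have EK : has_ubound E.
  exists K => _ [y [y01 py ->]]; rewrite ler_pdivrMr ?subr_gt0//.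
  have := lf y p y01 p01; rewrite [`|y - p|]gtr0_norm ?subr_gt0//.
  by move=> h; have := ler_norm (f y - f p); lra.
exists (sup E) => q q01.
have [qp|pq|->] := ltgtP q p; last by rewrite subrr mulr0 addr0.
(* Chord slopes decrease: for [q < p < y] the point [p] is a mixture of [q] and [y], so no slope to
   the right exceeds the slope from [q] to [p]. *)
- suff h : sup E <= (f p - f q) / (p - q).
    rewrite ler_pdivlMr ?subr_gt0// in h; lra.
  apply: ge_sup => // _ [y [y01 py ->]].
  rewrite ler_pdivrMr ?subr_gt0// mulrAC ler_pdivlMr ?subr_gt0//.
  have yq : 0 < y - q by lra.
  have z01 : 0 <= (y - p) / (y - q) <= 1.
    by rewrite divr_ge0 ?ler_pdivrMr ?mul1r//; lra.
  have := cf q y _ q01 y01 z01.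
  have -> : (y - p) / (y - q) * q + (1 - (y - p) / (y - q)) * y = p.
    by field; lra.
  have -> : (y - p) / (y - q) * f q + (1 - (y - p) / (y - q)) * f y =
    ((y - p) * f q + (p - q) * f y) / (y - q) by field; lra.
  rewrite ler_pdivrMr// => h; nra.
- have : (f q - f p) / (q - p) <= sup E by apply: ub_le_sup => //; exists q.
  by rewrite ler_pdivrMr ?subr_gt0//; lra.
Qed.

(** * Fixed point of the greedy Bellman operator *)

Section ValueFunction.
Context (R : realType) (ph : R -> R) (c e d : R).
Hypothesis ph01 : forall x, in_simplex x -> in_simplex (ph x).
Hypothesis phA : forall x y z, ph (z * x + (1 - z) * y) = z * ph x + (1 - z) * ph y.
Hypothesis phL : forall x y, `|ph x - ph y| <= `|x - y|.
Hypothesis d01 : 0 <= d < 1.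
Hypotheses (c01 : in_simplex c) (e01 : in_simplex e) (ce : c != e).
(** Affine coordinate with value 0 at [e] and 1 at [c]: I is [1 <= t x], and [t0] says that no
    belief lies beyond [e]. *)
Let t x := (x - e) / (c - e).
Hypothesis t0 : forall x, in_simplex x -> 0 <= t x.

Let h f x := d * f (ph x).

Definition greedy_chord f x := t x * (1 + h f c) + (1 - t x) * h f e.

Definition greedy_op f x := if 1 <= t x then 1 + h f x else greedy_chord f x.

Let d0 : 0 <= d. Proof. by case/andP: d01. Qed.
Let d1 : 0 < 1 - d. Proof. by case/andP: d01; rewrite subr_gt0. Qed.
Let ce0 : c - e != 0. Proof. by rewrite subr_eq0. Qed.
Let tE x : x = t x * c + (1 - t x) * e. Proof. by rewrite /t; field. Qed.

Let hconc f : concave01 f -> concave01 (h f).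
Proof.
move=> cf x y z x01 y01 z01; rewrite /h phA.
have := cf (ph x) (ph y) z (ph01 _ x01) (ph01 _ y01) z01.
by move=> /(ler_wpM2l d0); lra.
Qed.

(** On J, [x] mixes [c] and [e] with weight [t x < 1] on [c], so concavity of [h f] puts the chord
    below [t x + h f x]. *)
Lemma greedy_op_le_invest f x : concave01 f -> in_simplex x ->
  greedy_op f x <= 1 + h f x.
Proof.
move=> cf x01; rewrite /greedy_op; case: ifPn => //; rewrite -ltNge => tx1.
have := hconc _ cf c e (t x) c01 e01; rewrite -tE t0//= (ltW tx1) => /(_ isT).
by rewrite /greedy_chord; lra.
Qed.

(** On I, [c] mixes [x] and [e] with weight [(t x)^-1] on [x]; concavity of [h f] bounds [h f x] by
    extrapolation from [e] through [c], and [1 <= t x] covers the reward. *)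
Lemma greedy_op_le_chord f x : concave01 f -> in_simplex x ->
  greedy_op f x <= greedy_chord f x.
Proof.
move=> cf x01; rewrite /greedy_op; case: ifPn => // tx1.
have tx0 : 0 < t x by lra.
have := hconc _ cf x e (t x)^-1 x01 e01.
have -> : (t x)^-1 * x + (1 - (t x)^-1) * e = c.
  by rewrite {2}[x]tE; field; lra.
rewrite invr_ge0 (ltW tx0) invf_le1// tx1 => /(_ isT).
have -> : (t x)^-1 * h f x + (1 - (t x)^-1) * h f e =
  (h f x + (t x - 1) * h f e) / t x by field; lra.
by rewrite ler_pdivrMr// /greedy_chord; lra.
Qed.

Lemma greedy_op_concave f : concave01 f -> concave01 (greedy_op f).
Proof.
move=> cf x y z x01 y01 z01; have /andP[z0 z1] := z01.
have [ax bx] := (greedy_op_le_invest f x cf x01, greedy_op_le_chord f x cf x01).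
have [ay by_] := (greedy_op_le_invest f y cf y01, greedy_op_le_chord f y cf y01).
(* Only the branch at the mixture is unfolded; at [x] and [y] the matching one of the two upper
   bounds is used. *)
rewrite {3}/greedy_op; case: ifPn => _.
  have := hconc _ cf x y z x01 y01 z01; nra.
have -> : greedy_chord f (z * x + (1 - z) * y) =
    z * greedy_chord f x + (1 - z) * greedy_chord f y.
  rewrite /greedy_chord; have -> : t (z * x + (1 - z) * y) = z * t x + (1 - z) * t y.
    by rewrite /t; field.
  by ring.
nra.
Qed.

Let slope f := `|1 + h f c - h f e| / `|c - e|.

(** The branch taken at [y] also bounds [greedy_op f x], so an increment never exceeds that of a
    single branch: rate [d * K] for investing, since [ph] is 1-Lipschitz, and [slope f] on the
    chord. *)
Lemma greedy_op_lip f (K K' : R) : concave01 f -> lip01 K f ->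
  slope f <= K' -> d * K <= K' -> lip01 K' (greedy_op f).
Proof.
move=> cf lf sK' dK'.
have K0 : 0 <= K.
  have := lf c e c01 e01; have : 0 < `|c - e| by rewrite normr_gt0.
  by have := normr_ge0 (f c - f e); nra.
have aux x y : in_simplex x -> in_simplex y ->
    greedy_op f x - greedy_op f y <= K' * `|x - y|.
  move=> x01 y01; rewrite {2}/greedy_op; case: ifPn => _.
    apply: (@le_trans _ _ (d * (f (ph x) - f (ph y)))).
      by have := greedy_op_le_invest f x cf x01; rewrite /h; lra.
    apply: (@le_trans _ _ (d * (K * `|x - y|))).
      apply: ler_wpM2l => //; apply: le_trans (ler_norm _) _.
      by apply: (le_trans (lf _ _ (ph01 _ x01) (ph01 _ y01))); exact: ler_wpM2l.
    by rewrite mulrA ler_wpM2r.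
  apply: (@le_trans _ _ (greedy_chord f x - greedy_chord f y)).
    by have := greedy_op_le_chord f x cf x01; lra.
  have -> : greedy_chord f x - greedy_chord f y =
      (1 + h f c - h f e) / (c - e) * (x - y).
    by rewrite /greedy_chord /t; field.
  apply: le_trans (ler_norm _) _; rewrite normrM normf_div.
  by rewrite ler_wpM2r.
move=> x y x01 y01; rewrite ler_norml aux// andbT.
by rewrite -lerN2 opprK opprB distrC aux.
Qed.

(** Discounted total of a reward 1 at every stage. *)
Let C := (1 - d)^-1.

Let CE : C = 1 + d * C.
Proof. by rewrite /C; field; rewrite gt_eqF. Qed.

(** Value iteration from 0; it increases and stays below [C], so it converges pointwise. *)
Let it n := iter n greedy_op (fun=> 0).

Let it_bnd n x : in_simplex x -> 0 <= it n x <= C.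
Proof.
elim: n x => [|n IH] x x01; first by rewrite /= lexx invr_ge0 ltW.
have b y : in_simplex y -> 0 <= h (it n) y <= d * C.
  move=> y01; have /andP[? ?] := IH _ (ph01 _ y01).
  by rewrite /h mulr_ge0//= ler_wpM2l.
rewrite /= -/(it n) /greedy_op; case: ifPn.
  by have /andP[? ?] := b _ x01; have := CE; lra.
rewrite -ltNge => tx1; have tx0 := t0 _ x01.
have /andP[bc bc'] := b _ c01; have /andP[be be'] := b _ e01.
have CE' := CE; rewrite /greedy_chord; apply/andP; split; nra.
Qed.

Let it_mono n x : in_simplex x -> it n x <= it n.+1 x.
Proof.
elim: n x => [|n IH] x x01; first by have /andP[] := it_bnd 1 _ x01.
have b y : in_simplex y -> h (it n) y <= h (it n.+1) y.
  by move=> y01; rewrite /h ler_wpM2l// IH// ph01.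
rewrite [it n.+1]/= [it n.+2]/= -/(it n) -/(it n.+1) {1 2}/greedy_op.
case: ifPn => [_|]; first by rewrite lerD2l b.
rewrite -ltNge => tx1; have tx0 := t0 _ x01.
have bc := b _ c01; have be := b _ e01; rewrite /greedy_chord; nra.
Qed.

Definition greedy_value x : R := limn (fun n => iter n greedy_op (fun=> 0) x).
Let u := greedy_value.

Let u_cvg x : in_simplex x -> (fun n => it n x) @ \oo --> u x.
Proof.
move=> x01; apply: nondecreasing_is_cvgn.
  by apply/nondecreasing_seqP => n; exact: it_mono.
by exists C => _ [n _ <-]; have /andP[] := it_bnd n _ x01.
Qed.

Lemma greedy_value_bnd x : in_simplex x -> 0 <= u x <= (1 - d)^-1.
Proof.
move=> x01; have cu := u_cvg _ x01; rewrite -(cvg_lim _ cu)//.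
apply/andP; split.
  by apply: limr_ge; [apply: cvgP cu|apply: nearW => n; have /andP[] := it_bnd n _ x01].
by apply: limr_le; [apply: cvgP cu|apply: nearW => n; have /andP[] := it_bnd n _ x01].
Qed.

(** The branch of [greedy_op] depends on [x] alone and each branch reads [f] at finitely many
    points, so pointwise limits pass through the operator. *)
Lemma greedy_value_fix x : in_simplex x -> u x = greedy_op u x.
Proof.
move=> x01.
have ch y : in_simplex y -> (fun n => h (it n) y) @ \oo --> h u y.
  by move=> y01; apply: cvgMr; exact: u_cvg (ph01 _ y01).
have cS : (fun n => it n.+1 x) @ \oo --> greedy_op u x.
  rewrite /it /= /greedy_op; case: ifPn => _.
    by apply: cvgD; [exact: cvg_cst|exact: ch].
  apply: cvgD; apply: cvgMr; last exact: ch.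
  by apply: cvgD; [exact: cvg_cst|exact: ch].
have := u_cvg _ x01; rewrite -(cvg_shiftS) => cu.
exact: cvg_unique cu cS.
Qed.

Let it_concave n : concave01 (it n).
Proof.
elim: n => [|n IH]; last exact: greedy_op_concave.
by move=> x y z _ _ _ /=; rewrite !mulr0 addr0.
Qed.

(** Solves [K * |c - e| = 1 + d * K * |c - e|]: the chord rises by at most 1 plus the discounted
    increment of the previous iterate, so this constant reproduces itself. *)
Let K := (`|c - e| * (1 - d))^-1.

Let ce_gt0 : 0 < `|c - e|. Proof. by rewrite normr_gt0. Qed.
Let K0 : 0 < K. Proof. by rewrite invr_gt0 mulr_gt0. Qed.

Let it_lip n : lip01 K (it n).
Proof.
elim: n => [|n IH]; first by move=> x y _ _ /=; rewrite subrr normr0 mulr_ge0// ltW.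
apply: (greedy_op_lip _ _ _ (it_concave n) IH); last first.
  by have := K0; have := d0; have := d1; nra.
rewrite /slope ler_pdivrMr//.
have h1 : `|h (it n) c - h (it n) e| <= d * K * `|c - e|.
  rewrite /h -mulrBr normrM (ger0_norm d0) -mulrA ler_wpM2l//.
  apply: le_trans (IH _ _ (ph01 _ c01) (ph01 _ e01)) _.
  by rewrite ler_wpM2l// ltW.
have -> : K * `|c - e| = 1 + d * K * `|c - e|.
  by rewrite /K; field; rewrite ?gt_eqF//; lra.
rewrite -addrA; apply: le_trans (ler_normD _ _) _; rewrite normr1; lra.
Qed.

Lemma greedy_value_concave : concave01 u.
Proof.
move=> x y z x01 y01 z01; have w01 := in_simplex_conv _ _ _ _ x01 y01 z01.
have c1 : (fun n => z * it n x + (1 - z) * it n y) @ \oo --> z * u x + (1 - z) * u y.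
  by apply: cvgD; apply: cvgMr; exact: u_cvg.
have c2 := u_cvg _ w01.
rewrite -(cvg_lim _ c1)// -(cvg_lim _ c2)//; apply: ler_lim; [exact: cvgP c1|exact: cvgP c2|].
by apply: nearW => n; exact: it_concave.
Qed.

Let u_lipK : lip01 K u.
Proof.
move=> x y x01 y01.
have c1 : (fun n => `|it n x - it n y|) @ \oo --> `|u x - u y|.
  by apply: cvg_norm; apply: cvgB; exact: u_cvg.
rewrite -(cvg_lim _ c1)//; apply: limr_le; first exact: cvgP c1.
by apply: nearW => n; exact: it_lip.
Qed.

(* On the chord [u] has absolute slope [slope u]; elsewhere the dynamics contracts
   slopes by [d], so no Lipschitz constant above [slope u] can be optimal. *)
Lemma greedy_value_lip : lip01 (slope u) u.
Proof.
have uE K' : lip01 K' (greedy_op u) -> lip01 K' u.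
  by move=> l x y x01 y01; rewrite (greedy_value_fix x)// (greedy_value_fix y)//; exact: l.
have s0 : 0 <= slope u by rewrite divr_ge0.
(* From the crude constant [K], each use of [greedy_op_lip] gains a factor [d]; in the limit only
   [slope u] is left. *)
have l n : lip01 (Num.max (slope u) (d ^+ n * K)) u.
  elim: n => [|n IH].
    move=> x y x01 y01; apply: le_trans (u_lipK _ _ x01 y01) _.
    by rewrite ler_wpM2r// le_max expr0 mul1r lexx orbT.
  apply: uE; apply: (greedy_op_lip _ _ _ greedy_value_concave IH).
    by rewrite le_max lexx.
  rewrite maxr_pMr// ge_max !le_max exprS -!mulrA lexx orbT andbT.
  by apply/orP; left; have := d1; nra.
move=> x y x01 y01; apply/ler_addgt0Pr => eps eps0.
have cd : (fun n => d ^+ n * K * `|x - y|) @ \oo --> (0 * K * `|x - y| : R).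
  by do 2 apply: cvgMl; apply: cvg_expr; rewrite ger0_norm//; case/andP: d01.
have /cvgr_lt : (0 * K * `|x - y| : R) < eps by rewrite !mul0r.
move=> /(_ _ _ _ _ cd)[N _ /(_ N (leqnn N)) /= lN].
apply: le_trans (l N _ _ x01 y01) _.
rewrite maxr_pMl// ge_max lerDl (ltW eps0)/= (le_trans (ltW lN))//.
by rewrite lerDr mulr_ge0.
Qed.

(** On J the chord and [h u] agree at [e]; moving to [x], the chord rises by [S * t x], while [h u]
    rises by at most [d] times as much because [ph] is 1-Lipschitz. *)
Lemma greedy_value_wait x : in_simplex x -> d * u (ph x) <= u x.
Proof.
move=> x01.
set S := 1 + h u c - h u e.
have hlip y : in_simplex y -> `|h u y - h u e| <= d * (`|S| * t y).
  move=> y01; rewrite /h -mulrBr normrM (ger0_norm d0) ler_wpM2l//.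
  apply: le_trans (greedy_value_lip _ _ (ph01 _ y01) (ph01 _ e01)) _.
  apply: le_trans (ler_wpM2l _ (phL _ _)) _; first by rewrite divr_ge0.
  have -> // : slope u * `|y - e| = `|S| * t y.
  by rewrite -(ger0_norm (t0 _ y01)) /t normf_div /slope -/S mulrAC mulrA.
(* If [S < 0], then [h u c - h u e = S - 1] is a drop larger than [d * |S|], against [hlip]. *)
have S0 : 0 <= S.
  have := hlip _ c01; rewrite [t c]divff// mulr1 => hl.
  rewrite leNgt; apply/negP => Sneg; move: hl; rewrite (ltr0_norm Sneg) ler_norml.
  by have := d0; have := d1; rewrite /S in Sneg *; nra.
rewrite -/(h u x) (greedy_value_fix _ x01) /greedy_op; case: ifPn => _; first by rewrite lerDr.
have := hlip _ x01; rewrite (ger0_norm S0) ler_norml => /andP[_ hl].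
have St : 0 <= S * t x by rewrite mulr_ge0// t0.
rewrite /greedy_chord; have := d1; rewrite /S in St hl *; nra.
Qed.

End ValueFunction.

(** * Integrals against splittings *)

(* Holds without measurability because the integral of a nonnegative function
   is a supremum over the simple functions below it. *)
Lemma le_integral_nonmeasurable d (T : measurableType d) (R : realType)
    (mu : {measure set T -> \bar R}) (f g : T -> \bar R) :
  (forall x, 0 <= f x)%E -> (forall x, f x <= g x)%E ->
  (\int[mu]_x f x <= \int[mu]_x g x)%E.
Proof.
move=> f0 fg; have g0 x : (0 <= g x)%E by exact: le_trans (fg x).
rewrite !ge0_integralTE//; apply: le_ereal_sup => _ [s sf <-].
by exists s => // x; exact: le_trans (fg x).
Qed.

Definition two_point {R : realType} (mu : probability R R) (a x y : R) :=
  forall A, measurable A -> mu A = (a%:E * \d_x A + (1 - a)%:E * \d_y A)%E.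

Lemma ge0_integral_two_point (R : realType) (mu : probability R R)
    (a x y : R) (f : R -> \bar R) :
  0 <= a <= 1 -> two_point mu a x y -> measurable_fun setT f ->
  (forall z, 0 <= f z)%E ->
  (\int[mu]_z f z = a%:E * f x + (1 - a)%:E * f y)%E.
Proof.
move=> /andP[a0 a1] muE mf f0.
have b0 : 0 <= 1 - a by lra.
pose m1 := mscale (NngNum a0) (\d_x : {measure set R -> \bar R}).
pose m2 := mscale (NngNum b0) (\d_y : {measure set R -> \bar R}).
rewrite (eq_measure_integral (measure_add m1 m2)); last first.
  by move=> A mA _; rewrite [RHS]measure_addE; exact: muE.
rewrite ge0_integral_measure_add// !ge0_integral_mscale//.
by rewrite !integral_dirac// !diracT !mul1e.
Qed.

(** [F] is a measurable minorant of [f]: it keeps the values at [x] and [y] and vanishes elsewhere,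
    so its integral is the left-hand side. *)
Lemma two_point_integral_ge (R : realType) (mu : probability R R)
    (a x y : R) (f : R -> \bar R) :
  0 <= a <= 1 -> two_point mu a x y -> (forall z, 0 <= f z)%E ->
  (a%:E * f x + (1 - a)%:E * f y <= \int[mu]_z f z)%E.
Proof.
move=> a01 muE f0.
pose F z := if z == x then f x else if z == y then f y else 0%E.
have F0 z : (0 <= F z)%E by rewrite /F; do 2 (case: ifP => //).
have meq w : measurable_fun setT (fun z : R => z == w).
  apply: (measurable_fun_bool true); rewrite setTI.
  rewrite (_ : _ @^-1` _ = [set w]) //.
  by apply/seteqP; split => z /= => [/eqP//|->]; rewrite eqxx.
have mF : measurable_fun setT F.
  by do 2 (apply: measurable_fun_ifT => //).
have -> : (a%:E * f x + (1 - a)%:E * f y = \int[mu]_z F z)%E.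
  rewrite (ge0_integral_two_point _ _ _ _ _ _ a01 muE)// /F !eqxx.
  by case: eqP => // ->.
apply: le_integral_nonmeasurable => // z; rewrite /F.
by case: eqP => [->//|_]; case: eqP => [->//|_].
Qed.

Lemma measurable_simplex (R : realType) : measurable [set x : R | in_simplex x].
Proof.
by rewrite (_ : [set _ | _] = `[0, 1]%classic).
Qed.

Lemma two_point_splitting (R : realType) (mu : probability R R) (a x y : R) :
  0 <= a <= 1 -> two_point mu a x y -> in_simplex x -> in_simplex y ->
  is_splitting (a * x + (1 - a) * y) mu.
Proof.
move=> a01 muE x01 y01; split.
  rewrite muE; last exact: measurable_simplex.
  by rewrite !diracE !mem_set// !mule1 -EFinD subrKC.
have mE : measurable_fun setT (EFin : R -> \bar R) by exact: EFin_measurable.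
(* The identity changes sign on the line, so its positive and negative parts are integrated
   separately; the negative part vanishes at [x] and [y]. *)
rewrite integralE !(ge0_integral_two_point _ _ _ _ _ _ a01 muE)//; last 2 first.
- exact: measurable_funeneg.
- exact: measurable_funepos.
have pE (z : R) : in_simplex z -> (maxe z%:E 0 = z%:E /\ maxe (- z%:E) 0 = 0)%E.
  move=> /andP[z0 _]; split; first by apply/max_idPl; rewrite lee_fin.
  by apply/max_idPr; rewrite oppe_le0 lee_fin.
have [[px nx] [py ny]] := (pE _ x01, pE _ y01).
by rewrite !funeposE !funenegE px nx py ny !mule0 adde0 sube0.
Qed.

(** An affine majorant integrates to its value at the mean [p], which is [v]. *)
Lemma integral_splitting_le (R : realType) (mu : probability R R)
    (p k v C : R) (f : R -> \bar R) :
  is_splitting p mu -> (forall q, 0 <= f q <= C%:E)%E ->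
  (forall q, in_simplex q -> f q <= (v + k * (q - p))%:E)%E ->
  (\int[mu]_q f q <= v%:E)%E.
Proof.
move=> [muD mup] fC fv; set D := [set x | in_simplex x] in muD.
have mD : measurable D := measurable_simplex R.
have muND : mu (~` D) = 0%E by rewrite probability_setC// muD subee.
pose L q := v + k * (q - p).
have mL : measurable_fun setT L.
  by apply: measurable_funD => //; apply: measurable_funM => //; apply: measurable_funB.
(* Measurable nonnegative majorant of [f]; the constant [C] is used off the simplex, where [mu] has
   no mass. *)
pose F q := if in_simplex q then L q else C.
have C0 : 0 <= C by have /andP[/le_trans h /h] := fC 0; rewrite lee_fin.
have fF q : (f q <= (F q)%:E)%E.
  by rewrite /F; case: ifP => [/fv//|_]; have /andP[] := fC q.
have F0 q : (0 <= (F q)%:E)%E by apply: le_trans (fF q); have /andP[] := fC q.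
have mS : measurable_fun setT (fun q : R => in_simplex q).
  by apply: (measurable_fun_bool true); rewrite setTI.
have mF : measurable_fun setT (EFin \o F).
  by apply/measurable_EFinP; apply: measurable_fun_ifT.
have mE : measurable_fun setT (EFin : R -> \bar R) by exact: EFin_measurable.
have fF_int : (\int[mu]_q f q <= \int[mu]_q (EFin \o F) q)%E.
  by apply: le_integral_nonmeasurable => // q; have /andP[] := fC q.
apply: (le_trans fF_int).
rewrite (ge0_negligible_integral (measurableC mD) measurableT mF (fun x _ => F0 x) muND).
rewrite setTD setCK.
have mupD : (\int[mu]_(x in D) x%:E = p%:E)%E.
  rewrite -mup integral_mkcond; apply: ae_eq_integral => //.
    by apply/(measurable_restrictT _ _).1 => //; exact: measurable_funTS.
  exists (~` D); split => //; first exact: measurableC.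
  by move=> x /=; apply: contra_not => Dx _; rewrite patchE mem_set.
have iE : mu.-integrable D (EFin : R -> \bar R).
  apply: (measurable_bounded_integrable (f := @id R) mD) => //.
    by rewrite ltey_eq fin_num_measure.
  exists 1; split => // M M1 x /andP[x0 x1] /=.
  by rewrite ger0_norm// (le_trans x1)// ltW.
rewrite (eq_integral (fun x => (v - k * p)%:E + k%:E * x%:E)%E); last first.
  by move=> x /set_mem /= x01; rewrite /F x01 /L -EFinM -EFinD; congr EFin; ring.
rewrite integralD//=; last 2 first.
- by apply: finite_measure_integrable_cst.
- exact: integrableZl.
have -> : (\int[mu]_(x in D) (v - k * p)%:E = (v - k * p)%:E)%E.
  by rewrite integral_cst// -[RHS]mule1; congr (_ * _)%E.
rewrite integralZl// mupD -EFinM -EFinD lee_fin.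
by rewrite subrK.
Qed.

(** * The two-state chain, the investment region and the greedy rule *)

Lemma stochastic_bounds (R : realType) (M : bool -> bool -> R) w :
  stochastic M -> 0 <= M w true <= 1.
Proof.
move=> [M0 M1]; rewrite M0/=; have := M1 w; rewrite big_bool /=.
by have := M0 w false; lra.
Qed.

Lemma phi_simplex (R : realType) (M : bool -> bool -> R) x :
  stochastic M -> in_simplex x -> in_simplex (phi M x).
Proof.
move=> sM /andP[x0 x1].
have /andP[f0 f1] := stochastic_bounds _ _ false sM.
have /andP[t0 t1] := stochastic_bounds _ _ true sM.
by rewrite /in_simplex /phi; apply/andP; split; nra.
Qed.

Lemma phi_conv (R : realType) (M : bool -> bool -> R) x y z :
  phi M (z * x + (1 - z) * y) = z * phi M x + (1 - z) * phi M y.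
Proof. by rewrite /phi; ring. Qed.

(** [phi M] is affine; its slope, the second eigenvalue of [M], is a difference of two
    probabilities. *)
Lemma phi_lip (R : realType) (M : bool -> bool -> R) x y :
  stochastic M -> `|phi M x - phi M y| <= `|x - y|.
Proof.
move=> sM.
have /andP[f0 f1] := stochastic_bounds _ _ false sM.
have /andP[t0 t1] := stochastic_bounds _ _ true sM.
have -> : phi M x - phi M y = (M true true - M false true) * (x - y).
  by rewrite /phi; ring.
by rewrite normrM ler_piMl// ler_norml; lra.
Qed.

(* [(x - e) / (c - e)] is the affine coordinate that is 0 at the endpoint [e] of
   the simplex in J and 1 at the point [c] where the reward vanishes. *)
Lemma investment_region (R : realType) (r : bool -> R) :
  (exists x, inI r x) ->
  (forall x, in_simplex x -> inI r x) \/
  exists c e, [/\ in_simplex c, in_simplex e, c != e,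
    forall x, in_simplex x -> 0 <= (x - e) / (c - e) &
    forall x, in_simplex x -> inI r x = (1 <= (x - e) / (c - e))].
Proof.
move=> [x0 /andP[/andP[x00 x01]]]; rewrite /inI /pair_r => rx0.
set f := r false in rx0 *; set t := r true in rx0 *.
have [f0|f0] := leP 0 f; have [t0|t0] := leP 0 t.
- by left=> x y01; rewrite y01/=; case/andP: y01 => ? ?; nra.
(* I is the segment from 0 to [f / (f - t)], so [e] is 1. *)
- right; have ft : 0 < f - t by lra.
  have c1 : 0 < 1 - f / (f - t).
    by rewrite (_ : _ - _ = - t / (f - t)) ?divr_gt0; [|lra|lra|field; lra].
  exists (f / (f - t)), 1; split.
  + by rewrite /in_simplex divr_ge0//= ?ltW//; lra.
  + by rewrite /in_simplex ler01 lexx.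
  + by apply: contraTneq c1 => ->; rewrite subrr ltxx.
  + move=> x /andP[_ x1]; rewrite -mulrNN -invrN !opprB.
    by apply: divr_ge0; lra.
  + move=> x ->/=; rewrite -[in RHS]mulrNN -invrN !opprB ler_pdivlMr// mul1r.
    rewrite lerD2l lerN2 ler_pdivlMr//; apply/idP/idP; lra.
(* I is the segment from [- f / (t - f)] to 1, so [e] is 0. *)
- right; have ft : 0 < t - f by lra.
  have c0 : 0 < - f / (t - f) by rewrite divr_gt0; lra.
  exists (- f / (t - f)), 0; split.
  + by rewrite /in_simplex ltW//= ler_pdivrMr// mul1r; lra.
  + by rewrite /in_simplex ler01 lexx.
  + by rewrite gt_eqF.
  + by move=> x /andP[x0' _]; rewrite !subr0 divr_ge0// ltW.
  + move=> x ->/=; rewrite !subr0 ler_pdivlMr// mul1r ler_pdivrMr//.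
    by apply/idP/idP; lra.
- by exfalso; nra.
Qed.

Lemma greedy_rule_region (R : realType) (r : bool -> R) g :
  greedy_rule r g -> exists x, inI r x.
Proof.
move=> gr; have z01 : in_simplex (0 : R) by rewrite /in_simplex ler01 lexx.
have [_] := gr 0 z01; have [I0 _|_ /(_ isT)] := boolP (inI r 0); first by exists 0.
by move=> [aI [qI [qJ []]]]; exists qI.
Qed.

Lemma greedy_rule_invest (R : realType) (r : bool -> R) g p :
  greedy_rule r g -> inI r p -> two_point (g p) 1 p p.
Proof.
move=> gr Ip A mA; have /andP[p01 _] := Ip; have [/(_ Ip) gE _] := gr p p01.
by rewrite gE// mul1e subrr mul0e adde0.
Qed.

(** Since [t] is at least 1 on I and nonnegative everywhere, the weight on I is at most [t p]; the
    splitting between [c] and [e] attains this, and equality forces the posteriors. *)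
Lemma greedy_rule_wait (R : realType) (r : bool -> R) g c e p :
  greedy_rule r g -> in_simplex c -> in_simplex e -> c != e ->
  (forall x, in_simplex x -> 0 <= (x - e) / (c - e)) ->
  (forall x, in_simplex x -> inI r x = (1 <= (x - e) / (c - e))) ->
  in_simplex p -> ~~ inI r p -> two_point (g p) ((p - e) / (c - e)) c e.
Proof.
move=> gr c01 e01 ce; rewrite -subr_eq0 in ce.
pose t x := (x - e) / (c - e); rewrite -/(t p) => t0 IE p01 Jp A mA.
have tE x : x = t x * c + (1 - t x) * e by rewrite /t; field.
have [_ /(_ Jp)[aI [qI [qJ [/andP[a0 a1] IqI qJ01 pE [amax gE]]]]]] := gr p p01.
have tp1 : t p < 1 by rewrite IE// -ltNge in Jp.
have ta : t p <= aI.
  by apply: (amax _ c e) => //; [rewrite t0//= ltW|rewrite IE// divff].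
have qI01 : in_simplex qI by case/andP: IqI.
have tI : 1 <= t qI by rewrite -IE.
have tJ : 0 <= t qJ := t0 _ qJ01.
have tpE : t p = aI * t qI + (1 - aI) * t qJ by rewrite [in LHS]pE /t; field.
have aE : aI = t p by nra.
have tJ0 : t qJ = 0 by nra.
have qJE : qJ = e by rewrite [LHS]tE tJ0; ring.
rewrite gE// aE qJE.
(* At [p = e] the posterior [qI] is not determined, but it carries no mass. *)
have [tp0|tp0] := eqVneq (t p) 0; first by rewrite tp0 !mul0e.
have tI1 : t qI = 1.
  have := tpE; rewrite tJ0 mulr0 addr0 aE -{1}[t p]mulr1.
  by move=> /(mulfI tp0).
by have -> : qI = c by rewrite [LHS]tE tI1; ring.
Qed.

Definition invest_or_wait {R : realType} (M : bool -> bool -> R) r (delta : R) u q :=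
  (if inI r q then 1 else 0) + delta * u (phi M q).

(** Data for a verification argument: concavity, the Lipschitz bound and the [invest_or_wait]
    inequality bound every strategy by [u]; the two-point equation lets greedy attain [u]. *)
Lemma greedy_certificate (R : realType) (M : bool -> bool -> R) r delta g :
  stochastic M -> 0 <= delta < 1 -> greedy_rule r g ->
  exists u, [/\ forall x, in_simplex x -> 0 <= u x <= (1 - delta)^-1,
    concave01 u, exists K, lip01 K u,
    forall x, in_simplex x -> invest_or_wait M r delta u x <= u x &
    forall p, in_simplex p -> exists a x y,
      [/\ 0 <= a <= 1, in_simplex x /\ in_simplex y,
       p = a * x + (1 - a) * y, two_point (g p) a x y &
       u p = a * invest_or_wait M r delta u x +
             (1 - a) * invest_or_wait M r delta u y]].
Proof.
move=> sM d01 gr; have /andP[d0 d1] := d01.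
have one01 : 0 <= (1 : R) <= 1 by rewrite ler01 lexx.
have [allI|[c [e [c01 e01 ce t0 IE]]]] := investment_region R r (greedy_rule_region _ _ _ gr).
  have C0 : 0 <= (1 - delta)^-1 by rewrite invr_ge0; lra.
  have CE : (1 - delta)^-1 = 1 + delta * (1 - delta)^-1.
    by field; rewrite gt_eqF// subr_gt0.
  (* When I is the whole simplex every stage pays 1. *)
  exists (fun=> (1 - delta)^-1); split.
  - by move=> x _; rewrite C0 lexx.
  - by move=> x y z _ _ _; lra.
  - by exists 0 => x y _ _; rewrite subrr normr0 mul0r.
  - by move=> x x01; rewrite /invest_or_wait allI// -CE.
  - move=> p p01; exists 1, p, p; split => //.
    + by ring.
    + exact: greedy_rule_invest gr (allI _ p01).
    + by rewrite /invest_or_wait allI// -CE; ring.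
have ph01 := phi_simplex R M ^~ sM.
have phL := fun x y => phi_lip R M x y sM.
pose u := greedy_value R (phi M) c e delta.
have uE := greedy_value_fix _ _ _ _ _ ph01 d01 c01 e01 t0.
have Ic : inI r c by rewrite IE// divff// subr_eq0.
have Ie : inI r e = false by rewrite IE// subrr mul0r ler10.
exists u; split.
- exact: greedy_value_bnd.
- exact: (greedy_value_concave _ _ _ _ _ ph01 (@phi_conv R M)).
- exists (`|1 + delta * u (phi M c) - delta * u (phi M e)| / `|c - e|).
  exact: (greedy_value_lip _ _ _ _ _ ph01 (@phi_conv R M) phL).
- move=> x x01; rewrite /invest_or_wait IE//; case: ifPn => Ix.
    by rewrite [leRHS]uE// /greedy_op Ix.
  by rewrite add0r; exact: greedy_value_wait _ _ _ _ _ ph01 (@phi_conv R M) phL _ _ _ _ _ _ _.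
- move=> p p01; have [Ip|Jp] := boolP (inI r p).
    exists 1, p, p; split => //; first by ring.
      exact: greedy_rule_invest gr Ip.
    have : 1 <= (p - e) / (c - e) by rewrite -IE.
    by rewrite /invest_or_wait Ip {1}/u uE// /greedy_op => ->; rewrite -/u; ring.
  exists ((p - e) / (c - e)), c, e; split => //.
  + rewrite t0//=; move: Jp; rewrite IE// -ltNge; exact: ltW.
  + by field; rewrite subr_eq0.
  + exact: greedy_rule_wait gr c01 e01 ce t0 IE p01 Jp.
  + rewrite /invest_or_wait Ic Ie add0r {1}/u uE// /greedy_op.
    by move: Jp; rewrite IE// => /negbTE ->.
Qed.

(** * Measurability of the greedy strategy *)

Lemma measurable_greedy_rule (R : realType) (r : bool -> R) g (A : set R) :
  greedy_rule r g -> measurable A ->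
  measurable_fun [set x : R | in_simplex x] ((fun p => g p A) : R -> \bar R).
Proof.
move=> gr mA.
have mI : measurable_fun setT (\1_A : R -> R) by exact: measurable_indic.
have [allI|[c [e [c01 e01 ce t0 IE]]]] := investment_region R r (greedy_rule_region _ _ _ gr).
  apply: (eq_measurable_fun (EFin \o \1_A)).
    move=> p /set_mem p01; have [/(_ (allI _ p01)) -> //] := gr p p01.
  by apply: measurable_funTS; exact/measurable_EFinP.
pose t x := (x - e) / (c - e).
have mt : measurable_fun setT t.
  by apply: measurable_funM => //; exact: measurable_funB.
(* Explicit mass of [A] under the rule: Dirac at [p] on I, the mixture of [c] and [e] on J. *)
pose G p := if 1 <= t p then \1_A p else t p * \1_A c + (1 - t p) * \1_A e.
apply: (eq_measurable_fun (EFin \o G)).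
  move=> p /set_mem p01 /=; rewrite /G; have := IE p p01; rewrite -/(t p) => <-.
  have [Ip|Jp] := boolP (inI r p).
    by have [/(_ Ip) -> //] := gr p p01.
  by rewrite (greedy_rule_wait _ _ _ _ _ _ gr c01 e01 ce t0 IE p01 Jp).
apply: measurable_funTS; apply/measurable_EFinP; apply: measurable_fun_ifT => //.
  exact: measurable_fun_ler.
apply: measurable_funD; apply: measurable_funM => //; exact: measurable_funB.
Qed.

Lemma belief_rcons (R : realType) (M : bool -> bool -> R) p1 n (h : n.-tuple R) q :
  belief M p1 [tuple of rcons h q] = phi M q.
Proof. by case: h => -[|x h] sz; rewrite /belief //= last_rcons. Qed.

Lemma belief_simplex (R : realType) (M : bool -> bool -> R) p1 (h : seq R) :
  stochastic M -> in_simplex p1 -> in_simplex_hist h ->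
  in_simplex (belief M p1 h).
Proof.
move=> sM p01; case: h => [//|x h] /allP /(_ _ (mem_last x h)) l01.
by rewrite /belief; exact: phi_simplex.
Qed.

Lemma measurable_in_simplex_hist (R : realType) n :
  measurable [set h : n.-tuple R | in_simplex_hist h].
Proof.
have -> : [set h : n.-tuple R | in_simplex_hist h] =
    \bigcap_(i in [set: 'I_n]) ((@tnth n R)^~ i @^-1` [set x | in_simplex x]).
  apply/seteqP; split=> h /=; first by move=> /all_tnthP H i _ /=; exact: H.
  by move=> H; apply/all_tnthP => i; exact: H.
apply: fin_bigcap_measurable => // i _.
by rewrite -[_ @^-1` _]setTI; apply: measurable_tnth => //; exact: measurable_simplex.
Qed.

Lemma measurable_belief (R : realType) (M : bool -> bool -> R) p1 n :
  measurable_fun setT (fun h : n.-tuple R => belief M p1 h).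
Proof.
case: n => [|n].
  rewrite (_ : (fun h => _) = cst p1); first exact: measurable_cst.
  by apply/funext => h; rewrite tuple0.
rewrite (_ : (fun h => _) = phi M \o (@tnth n.+1 R)^~ ord_max).
  apply: measurableT_comp; last exact: measurable_tnth.
  apply: measurable_funD; apply: measurable_funM => //.
  exact: measurable_funB.
apply/funext => h /=; rewrite (tnth_nth 0) /= -[X in nth _ _ X]/n.+1.-1.
by rewrite -[X in X.-1](size_tuple h) nth_last; case: h => -[].
Qed.

Lemma greedy_strategy_measurable (R : realType) (M : bool -> bool -> R) r g p1 n
    (A : set R) : stochastic M -> greedy_rule r g -> in_simplex p1 ->
  measurable A ->
  measurable_fun setT ((fun h => greedy_strategy M p1 g h A) : n.-tuple R -> \bar R).
Proof.
move=> sM gr p01 mA.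
rewrite (_ : (fun h => _) = fun h : n.-tuple R =>
  if in_simplex_hist h then g (belief M p1 h) A else g p1 A); last first.
  by apply/funext => h; rewrite /greedy_strategy; case: ifP.
have mH := measurable_in_simplex_hist R n.
apply: measurable_fun_if => //.
  by apply: (measurable_fun_bool true); rewrite setTI.
(* The rule is controlled only on the simplex, which contains the beliefs after histories in the
   simplex. *)
rewrite setTI; apply: (measurable_comp (f := (fun p => g p A) : R -> \bar R)
  (g := fun h : n.-tuple R => belief M p1 h) (measurable_simplex R)).
- by move=> _ [h hH <-]; exact: belief_simplex.
- exact: measurable_greedy_rule gr mA.
- by apply: measurable_funTS; exact: measurable_belief.
Qed.

(** * Finite-horizon payoffs compared with [u] *)

Section Payoffs.
Context (R : realType) (M : bool -> bool -> R) (r : bool -> R) (delta : R).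
Hypotheses (sM : stochastic M) (d01 : 0 <= delta < 1).
Implicit Types (s : strategy R).

Let d0 : 0 <= delta. Proof. by case/andP: d01. Qed.
Let C := (1 - delta)^-1.
Let CE : C = 1 + delta * C.
Proof. by rewrite /C; field; rewrite gt_eqF// subr_gt0; case/andP: d01. Qed.
Let C0 : 0 <= C. Proof. by rewrite invr_ge0; case/andP: d01; lra. Qed.

Let integrand s N n (h : n.-tuple R) q : \bar R :=
  ((if inI r q then 1 else 0)%:E
    + delta%:E * Wfin r delta s N [tuple of rcons h q])%E.

Let stage_bnd b (w : \bar R) : (0 <= w <= C%:E)%E ->
  (0 <= (if b then 1 else 0)%:E + delta%:E * w <= C%:E)%E.
Proof.
move=> /andP[w0 wC].
rewrite adde_ge0 ?mule_ge0 ?lee_fin//=; last by case: b.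
by rewrite CE EFinD EFinM leeD ?lee_wpmul2l ?lee_fin//; case: b.
Qed.

Lemma Wfin_bnd s N n (h : n.-tuple R) :
  (0 <= Wfin r delta s N h <= (1 - delta)^-1%:E)%E.
Proof.
elim: N n h => [|N IH] n h /=; first by rewrite lexx lee_fin.
have b q : (0 <= integrand s N n h q <= C%:E)%E by exact: stage_bnd.
rewrite integral_ge0/=; last by move=> q _; have /andP[] := b q.
have : (\int[s n h]_q integrand s N n h q <= \int[s n h]_q (cst C%:E) q)%E.
  by apply: le_integral_nonmeasurable => q; have /andP[] := b q.
move=> /le_trans; apply; rewrite integral_cst// -[leRHS]mule1.
by apply: lee_wpmul2l; [rewrite lee_fin|exact: probability_le1].
Qed.

Let integrand_bnd s N n (h : n.-tuple R) q : (0 <= integrand s N n h q <= C%:E)%E.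
Proof. by apply: stage_bnd; exact: Wfin_bnd. Qed.

Variable u : R -> R.
Hypothesis u_bnd : forall x, in_simplex x -> 0 <= u x <= (1 - delta)^-1.

(** Induction on the horizon: a supporting line of [u] at the current belief dominates the stage
    reward plus continuation at every posterior in the simplex, and a splitting preserves the
    mean. *)
Lemma Wfin_le p1 s N n (h : n.-tuple R) :
  concave01 u -> (exists K, lip01 K u) ->
  (forall x, in_simplex x -> invest_or_wait M r delta u x <= u x) ->
  in_simplex p1 -> is_strategy M p1 s -> in_simplex_hist h ->
  (Wfin r delta s N h <= (u (belief M p1 h))%:E)%E.
Proof.
move=> cu [K lu] wu p01 [_ ss]; elim: N n h => [|N IH] n h hH.
  by rewrite lee_fin; have /andP[] := u_bnd _ (belief_simplex _ _ _ _ sM p01 hH).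
have b01 := belief_simplex _ _ _ _ sM p01 hH.
have [k hk] := concave01_supergradient _ _ _ _ cu lu b01.
apply: (integral_splitting_le _ _ _ k _ C _ (ss n h hH)) => q.
  exact: integrand_bnd.
move=> q01; apply: (@le_trans _ _ (u q)%:E); last by rewrite lee_fin hk.
apply: (@le_trans _ _ (invest_or_wait M r delta u q)%:E); last by rewrite lee_fin wu.
rewrite /invest_or_wait EFinD EFinM leeD2l// lee_wpmul2l ?lee_fin//.
rewrite -(belief_rcons _ _ p1 _ h q); apply: IH.
by rewrite /in_simplex_hist all_rcons q01.
Qed.

(** Stopping after [N] stages forgoes a continuation worth at most [(1 - delta)^-1], discounted [N]
    times. *)
Lemma greedy_Wfin_ge p1 g N n (h : n.-tuple R) :
  (forall p, in_simplex p -> exists a x y,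
      [/\ 0 <= a <= 1, in_simplex x /\ in_simplex y,
       p = a * x + (1 - a) * y, two_point (g p) a x y &
       u p = a * invest_or_wait M r delta u x +
             (1 - a) * invest_or_wait M r delta u y]) ->
  in_simplex p1 -> in_simplex_hist h ->
  ((u (belief M p1 h) - delta ^+ N * (1 - delta)^-1)%:E <=
     Wfin r delta (greedy_strategy M p1 g) N h)%E.
Proof.
move=> cert p01; elim: N n h => [|N IH] n h hH.
  rewrite expr0 mul1r lee_fin subr_le0.
  by have /andP[] := u_bnd _ (belief_simplex _ _ _ _ sM p01 hH).
have [a [x [y [a01 [x01 y01] bE gE uE]]]] :=
  cert _ (belief_simplex _ _ _ _ sM p01 hH).
have /andP[a0 a1] := a01.
set s := greedy_strategy M p1 g in IH *.
have sE : two_point (s n h) a x y by rewrite /s /greedy_strategy hH.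
have low q : in_simplex q ->
    ((invest_or_wait M r delta u q - delta ^+ N.+1 * C)%:E <= integrand s N n h q)%E.
  move=> q01; rewrite /invest_or_wait -addrA EFinD leeD2l//.
  rewrite exprS -mulrA -mulrBr EFinM lee_wpmul2l ?lee_fin//.
  rewrite -(belief_rcons _ _ p1 _ h q); apply: IH.
  by rewrite /in_simplex_hist all_rcons q01.
apply: (le_trans _ (two_point_integral_ge _ _ _ _ _ (integrand s N n h) a01 sE _)); last first.
  by move=> q; have /andP[] := integrand_bnd s N _ h q.
apply: (le_trans _ (leeD (lee_wpmul2l _ (low _ x01)) (lee_wpmul2l _ (low _ y01)))).
- by rewrite -!EFinM -EFinD lee_fin uE -/C; lra.
- by rewrite lee_fin.
- by rewrite lee_fin subr_ge0.
Qed.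

End Payoffs.

(** * Verification: greedy attains the common upper bound *)

Theorem theorem1 (R : realType) (M : bool -> bool -> R) (r : bool -> R)
  (delta : R) (g : R -> probability R R) :
  stochastic M -> irreducible M -> 0 <= delta < 1 -> greedy_rule r g ->
  forall p1 : R, in_simplex p1 ->
    is_strategy M p1 (greedy_strategy M p1 g) /\
    payoff r delta (greedy_strategy M p1 g) = value M r delta p1.
Proof.
move=> sM _ d01 gr p1 p01; have /andP[d0 d1] := d01.
have [u [ub cu lu wu cert]] := greedy_certificate _ M _ _ _ sM d01 gr.
have isg : is_strategy M p1 (greedy_strategy M p1 g).
  split=> [n A mA|n h hH]; first exact: greedy_strategy_measurable gr p01 mA.
  have [a [x [y [a01 [x01 y01] bE gE _]]]] :=
    cert _ (belief_simplex _ _ _ _ sM p01 hH).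
  by rewrite bE /greedy_strategy hH; exact: two_point_splitting.
split => //.
have nil01 : in_simplex_hist ([tuple] : 0.-tuple R) by [].
have up s : is_strategy M p1 s ->
    (ereal_sup [set Wfin r delta s N [tuple] | N in [set: nat]] <= (u p1)%:E)%E.
  move=> ss; apply: ge_ereal_sup => _ [N _ <-].
  exact: (Wfin_le R M r delta sM d01 u ub p1 s N 0 [tuple]).
have dpos : (0 <= (1 - delta)%:E)%E by rewrite lee_fin; lra.
have gE : payoff r delta (greedy_strategy M p1 g) = ((1 - delta)%:E * (u p1)%:E)%E.
  congr (_ * _)%E; apply/eqP; rewrite eq_le up//=.
  (* A horizon is chosen whose truncation error is below [eps]. *)
  apply/lee_addgt0Pr => eps eps0.
  have cd : (fun n => delta ^+ n * (1 - delta)^-1) @ \oo --> (0 * (1 - delta)^-1 : R).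
    by apply: cvgMl; apply: cvg_expr; rewrite ger0_norm.
  have /cvgr_lt : (0 * (1 - delta)^-1 : R) < eps by rewrite mul0r.
  move=> /(_ _ _ _ _ cd)[N _ /(_ N (leqnn N)) /= lN].
  have := greedy_Wfin_ge R M r delta sM d01 u ub p1 g N 0 [tuple] cert p01 nil01.
  rewrite [belief _ _ _]/=.
  move=> lo; apply: (@le_trans _ _ ((u p1 - delta ^+ N * (1 - delta)^-1)%:E + eps%:E)%E).
    by rewrite -EFinD lee_fin; lra.
  by rewrite leeD2r// (le_trans lo)//; apply: ereal_sup_ubound; exists N.
apply/eqP; rewrite eq_le; apply/andP; split.
  by apply: ereal_sup_ubound; exists (greedy_strategy M p1 g).
apply: ge_ereal_sup => _ [s ss <-]; rewrite gE.
by apply: lee_wpmul2l => //; exact: up.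
Qed.
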